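(* Let $L$ be a $1$-bounded, one-sorted metric signature. Then every compact $L$-structure is almost pseudofinite. Consequently, for every $L$-structure $Z$: if $Z$ is pseudocompact, then $Z$ is almost pseudofinite; and if $Z$ is almost pseudofinite, then $Z$ is almost pseudocompact.
   Context: Continuous first-order logic for metric structures (Ben Yaacov–Berenstein–Henson–Usvyatsov) is used. For a $1$-bounded one-sorted metric signature $L$, $L$-structures are complete metric spaces of diameter at most $1$ with interpretations of the symbols; predicates are $[0,1]$-valued. Each function or predicate symbol $s$ has a modulus of uniform continuity $\Delta_s$: for every $\epsilon>0$ and all tuples $a,b$, $d(a,b)<\Delta_s(\epsilon)$ implies $d(f(a),f(b))\le\epsilon$ (for $s=f$ a function symbol), respectively $|P(a)-P(b)|\le\epsilon$ (for $s=P$ a predicate symbol); tuples carry the maximum metric. Connectives are all continuous functions $[0,1]^n\to[0,1]$, quantifiers are $\sup$ and $\inf$. The value of a sentence $\sigma$ in $M$ is $\sigma^M\in[0,1]$. A (possibly almost) $L$-structure is finite (resp. compact) if its underlying metric space is. An almost $L$-structure is defined exactly as an $L$-structure, except that the modulus clause for each function or predicate symbol $s$ is only required to hold for all sufficiently small $\epsilon>0$ (the threshold may depend on the structure and the symbol). Every $L$-structure is an almost $L$-structure. An $L$-structure $Z$ is pseudocompact if $\sigma^Z=0$ for every $L$-sentence $\sigma$ such that $\sigma^A=0$ for all compact $L$-structures $A$. An $L$-structure $Z$ is almost pseudofinite (resp. almost pseudocompact) if $\sigma^Z=0$ for every $L$-sentence $\sigma$ such that $\sigma^A=0$ for all finite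 (resp. compact) almost $L$-structures $A$. *)

(* Defs.v *)
From HB Require Import structures.
From mathcomp Require Import all_boot all_order all_algebra.
From mathcomp Require Import all_classical all_reals all_analysis.

Set Implicit Arguments.
Unset Strict Implicit.
Unset Printing Implicit Defensive.

Import Order.TTheory GRing.Theory Num.Theory.
Import numFieldNormedType.Exports.

Local Open Scope classical_set_scope.
Local Open Scope ring_scope.

(* One-sorted, 1-bounded signatures. Constants are the function symbols of
   arity 0. A modulus is a function (0, +oo) -> (0, +oo); its values at
   arguments e <= 0 are never used. The metric is a logical symbol. *)
Record signature (R : realType) := Signature {
  fsym : Type;
  psym : Type;
  farity : fsym -> nat;
  parity : psym -> nat;
  fmodulus : fsym -> R -> R;
  pmodulus : psym -> R -> R;
  fmodulus_gt0 : forall f e, 0 < e -> 0 < fmodulus f e;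
  pmodulus_gt0 : forall P e, 0 < e -> 0 < pmodulus P e
}.

Definition unit_cube (R : realType) (k : nat) : set 'rV[R]_k :=
  [set x | forall i, 0 <= x ord0 i <= 1].

(* Continuous functions [0,1]^k -> [0,1]. The values outside of the cube are
   irrelevant. *)
Record connective (R : realType) (k : nat) := Connective {
  conn_fun :> 'rV[R]_k -> R;
  conn_itv : forall x, unit_cube x -> 0 <= conn_fun x <= 1;
  conn_continuous : {within @unit_cube R k, continuous conn_fun}
}.

Section Syntax.
Variables (R : realType) (L : signature R).

(* Well-scoped de Bruijn syntax: the free variables of an element of [term n]
   or [formula n] are among the n variables indexed by 'I_n. A quantifier binds
   the variable ord0 and shifts the others by one. *)
Inductive term (n : nat) : Type :=
| Var (i : 'I_n)
| App (f : fsym L) (ts : 'I_(farity f) -> term n).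

Inductive formula : nat -> Type :=
| Dist n (t u : term n) : formula n
| Pred n (P : psym L) (ts : 'I_(parity P) -> term n) : formula n
| Conn n k (c : connective R k) (phis : 'I_k -> formula n) : formula n
| QSup n (psi : formula n.+1) : formula n
| QInf n (psi : formula n.+1) : formula n.

Definition sentence := formula 0.

End Syntax.

(* The data shared by L-structures and almost L-structures: everything except
   the modulus clauses. *)
Record raw_structure (R : realType) (L : signature R) := RawStructure {
  carrier :> metricType R;
  carrier_nonempty : [set: carrier] !=set0;
  carrier_complete : forall F : set_system carrier,
    ProperFilter F -> cauchy F -> exists x : carrier, F --> x;
  carrier_diam : forall x y : carrier, mdist x y <= 1;
  finterp : forall f : fsym L, ('I_(farity f) -> carrier) -> carrier;
  pinterp : forall P : psym L, ('I_(parity P) -> carrier) -> R;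
  pinterp_itv : forall (P : psym L) a, 0 <= @pinterp P a <= 1
}.

Section Structures.
Variables (R : realType) (L : signature R).
Implicit Types (M : raw_structure L) (s : sentence L).

Definition tuple_dist M (n : nat) (a b : 'I_n -> M) : R :=
  \big[Num.max/0]_(i < n) mdist (a i) (b i).

Definition fmodulus_clause M (f : fsym L) (e : R) : Prop :=
  forall a b : 'I_(farity f) -> M,
    tuple_dist a b < fmodulus f e -> mdist (finterp a) (finterp b) <= e.

Definition pmodulus_clause M (P : psym L) (e : R) : Prop :=
  forall a b : 'I_(parity P) -> M,
    tuple_dist a b < pmodulus P e -> `|pinterp a - pinterp b| <= e.

Definition is_structure M : Prop :=
  (forall f e, 0 < e -> fmodulus_clause M f e) /\
  (forall P e, 0 < e -> pmodulus_clause M P e).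

Definition is_almost_structure M : Prop :=
  (forall f, \forall e \near 0^'+, fmodulus_clause M f e) /\
  (forall P, \forall e \near 0^'+, pmodulus_clause M P e).

Lemma structure_is_almost M : is_structure M -> is_almost_structure M.
Proof.
by move=> [Mf Mp]; split=> s; near=> e; [apply: Mf | apply: Mp].
Unshelve. all: by end_near. Qed.

Definition is_finite M : Prop := finite_set [set: M].
Definition is_compact M : Prop := compact [set: M].

Fixpoint term_val M n (v : 'I_n -> M) (t : term L n) : M :=
  match t with
  | Var i => v i
  | App f ts => finterp (fun i => term_val v (ts i))
  end.

Definition extend M n (x : M) (v : 'I_n -> M) : 'I_n.+1 -> M :=
  fun i => if unlift ord0 i is Some j then v j else x.

Fixpoint formula_val M n (phi : formula L n) : ('I_n -> M) -> R :=
  match phi with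
  | Dist _ t u => fun v => mdist (term_val v t) (term_val v u)
  | Pred _ P ts => fun v => pinterp (fun i => term_val v (ts i))
  | Conn _ _ c phis => fun v => c (\row_i formula_val (phis i) v)
  | QSup _ psi => fun v => sup (range (fun x => formula_val psi (extend x v)))
  | QInf _ psi => fun v => inf (range (fun x => formula_val psi (extend x v)))
  end.

Lemma formula_val_itv M n (phi : formula L n) (v : 'I_n -> M) :
  0 <= formula_val phi v <= 1.
Proof.
elim: phi v => {n} [n t u|n P ts|n k c phis IH|n psi IH|n psi IH] v /=.
- by rewrite mdist_ge0 carrier_diam.
- exact: pinterp_itv.
- by apply: conn_itv => i; rewrite mxE.
- have [x _] := carrier_nonempty M.
  have ub1 : ubound (range (fun x => formula_val psi (extend x v))) 1.
    by move=> _ [y _ <-]; case/andP: (IH (extend y v)).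
  apply/andP; split; last first.
    by apply: ge_sup ub1; exists (formula_val psi (extend x v)), x.
  have /andP[ge0 _] := IH (extend x v); apply: le_trans ge0 _.
  by apply: ub_le_sup; [exists 1 | exists x].
- have [x _] := carrier_nonempty M.
  have lb0 : lbound (range (fun x => formula_val psi (extend x v))) 0.
    by move=> _ [y _ <-]; case/andP: (IH (extend y v)).
  apply/andP; split.
    by apply: lb_le_inf lb0; exists (formula_val psi (extend x v)), x.
  have /andP[_ le1] := IH (extend x v); apply: le_trans le1.
  by apply: ge_inf; [exists 0 | exists x].
Qed.

Definition no_vars (T : Type) : 'I_0 -> T :=
  fun i => False_rect T (notF (ltn_ord i)).

Definition sentence_val M s : R := formula_val s (@no_vars M).

Definition pseudocompact (Z : raw_structure L) : Prop :=
  forall s,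
    (forall A : raw_structure L,
       is_structure A -> is_compact A -> sentence_val A s = 0) ->
    sentence_val Z s = 0.

Definition almost_pseudofinite (Z : raw_structure L) : Prop :=
  forall s,
    (forall A : raw_structure L,
       is_almost_structure A -> is_finite A -> sentence_val A s = 0) ->
    sentence_val Z s = 0.

Definition almost_pseudocompact (Z : raw_structure L) : Prop :=
  forall s,
    (forall A : raw_structure L,
       is_almost_structure A -> is_compact A -> sentence_val A s = 0) ->
    sentence_val Z s = 0.

End Structures.

(* Main.v *)
Require Import Defs.
From HB Require Import structures.
From mathcomp Require Import all_boot all_order all_algebra.
From mathcomp Require Import all_classical all_reals all_analysis.
From mathcomp Require Import finmap lra.

(** Let [A] be a compact structure and [S] a finite [d]-dense subset of [A] with
    a map [r : A -> S] that moves points by less than [d]. Interpret a function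
    symbol [f] on [S] as [r \o f] and restrict the predicates. This is an almost
    structure: if [e] is below all the nonzero distances between values of [f]
    at tuples of [S], then the modulus clause of [A] at [e] says that tuples of
    [S] at distance less than the modulus have the same image under [f], hence
    under [r \o f]. As [d] tends to 0, the value of any formula on [S]
    converges to its value on [A], uniformly in the parameters, so a sentence
    that vanishes on all finite almost structures vanishes on [A]. *)

Set Implicit Arguments.
Unset Strict Implicit.
Unset Printing Implicit Defensive.

Import Order.TTheory GRing.Theory Num.Theory.
Import numFieldNormedType.Exports.

Local Open Scope classical_set_scope.
Local Open Scope ring_scope.

(** * Uniform continuity, estimates for sup and inf, gaps in finite sets of reals *)

Lemma compact_uniform_continuity (R : realType) (T : pseudoMetricType R)
    (K : set T) (f : T -> R) (e : R) :
    compact K -> {within K, continuous f} -> 0 < e ->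
  \forall d \near 0^'+,
    forall x y, K x -> K y -> ball x d y -> `|f x - f y| < e.
Proof.
move=> /compact_near_coveringP/near_covering_withinP Kcov fcont e0.
have e20 : 0 < e / 2 by rewrite divr_gt0.
pose P (d : R) x := forall y, K y -> ball x d y -> `|f x - f y| < e.
(* Compactness in near-covering form turns a threshold on [d] valid near each point into one valid
   on all of [K]. *)
suff /(Kcov _ _ P) : forall x, K x ->
    \forall x' \near x & d \near 0^'+, K x' -> P d x'.
  by apply: filterS => d Kd x y Kx; exact: Kd.
move=> x Kx.
have := fcont x => /(_ (ball (f x) (e / 2)) (nbhsx_ballx _ _ e20)).
rewrite /nbhs/= -nbhs_subspace_in// => /nbhs_ballP[r /= r0 rball].
(* Halving the radius keeps both [z] and any [y] within [d] of [z] in the ball of radius [r], where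
   [f] stays within [e / 2] of [f x]. *)
exists (ball x (r / 2), [set d | d < r / 2]); first split => /=.
- by apply: nbhsx_ballx; rewrite divr_gt0.
- by apply: nbhs_right_lt; rewrite divr_gt0.
move=> [z d] /= [xz dr] Kz y Ky zy.
have xzr : ball x r z.
  by apply: le_ball xz; rewrite ler_pdivrMr// ler_pMr// ler1n.
have xyr : ball x r y.
  rewrite (splitr r); apply: ball_triangle xz _.
  exact: le_ball (ltW dr) _ zy.
have := rball _ xzr Kz; have := rball _ xyr Ky; rewrite /ball/= => yx zx.
have -> : f z - f y = (f x - f y) - (f x - f z) by lra.
by rewrite (splitr e) (le_lt_trans (ler_normB _ _))// ltrD.
Qed.

Lemma compact_unit_cube (R : realType) (k : nat) : compact (@unit_cube R k).
Proof.
rewrite (_ : @unit_cube R k =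
    [set v : 'rV[R]_k | forall i, `[0, 1]%classic (v ord0 i)]).
  exact: (@rV_compact R k _ (fun=> @segment_compact R 0 1)).
by apply/seteqP; split => v vi i; have := vi i; rewrite /= in_itv.
Qed.

(** Nonemptiness and the bound [M] make both sides genuine suprema rather than the default value of
    [sup]. *)
Lemma sup_range_le (R : realType) (B A : Type) (f : B -> R) (g : A -> R)
    (M e : R) :
    (exists x : B, True) -> (forall y, g y <= M) ->
    (forall x, exists y, f x <= g y + e) ->
  sup (range f) <= sup (range g) + e.
Proof.
move=> [b _] gM fg; apply: ge_sup; first by exists (f b), b.
move=> _ [x _ <-]; have [y /le_trans] := fg x; apply.
rewrite lerD2r; apply: ub_le_sup; last by exists y.
by exists M => _ [z _ <-].
Qed.

Lemma inf_range_le (R : realType) (B A : Type) (f : B -> R) (g : A -> R)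
    (m e : R) :
    (exists y : A, True) -> (forall x, m <= f x) ->
    (forall y, exists x, f x <= g y + e) ->
  inf (range f) <= inf (range g) + e.
Proof.
move=> [a _] fm fg; rewrite -lerBlDr; apply: lb_le_inf.
  by exists (g a), a.
move=> _ [y _ <-]; rewrite lerBlDr; have [x] := fg y; apply: le_trans.
apply: ge_inf; last by exists x.
by exists m => _ [z _ <-].
Qed.

(** It suffices to take [e] below each of the finitely many positive values. Applied to distances,
    this makes small ones vanish. *)
Lemma near_finite_gap (R : realType) (T : finType) (g : T -> R) :
  \forall e \near 0^'+, forall t, g t <= e -> g t <= 0.
Proof.
apply: filter_forall => t; have [gt0|gt0] := leP (g t) 0; first exact: nearW.
near=> e; rewrite leNgt => /negP[].
by near: e; exact: nbhs_right_lt.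
Unshelve. all: by end_near. Qed.

Lemma mdist_dist_le (R : realType) (T : metricType R) (x y x' y' : T) :
  `|mdist x y - mdist x' y'| <= mdist x x' + mdist y y'.
Proof.
have := metric_triangle x x' y; have := metric_triangle x' y' y.
have := metric_triangle x' x y'; have := metric_triangle x y y'.
rewrite (metric_sym x' x) (metric_sym y' y) ler_norml; lra.
Qed.

(** * Stability of terms and formulas under approximation *)

Section Approximation.
Variables (R : realType) (L : signature R).
Implicit Types A B : raw_structure L.

(** Isolates what rounding to a net preserves: only function values are perturbed, by less than
    [d]. *)
Record approximates A B (iota : B -> A) (d : R) : Prop := Approximates {
  approx_isometry : forall x y, mdist (iota x) (iota y) = mdist x y;
  approx_dense : forall y, exists x, mdist (iota x) y < d;
  approx_finterp : forall f (a : 'I_(farity f) -> B),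
    mdist (iota (finterp a)) (finterp (iota \o a)) < d;
  approx_pinterp : forall P (a : 'I_(parity P) -> B),
    pinterp a = pinterp (iota \o a)
}.

Lemma approx_gt0 A B (iota : B -> A) (d : R) : approximates iota d -> 0 < d.
Proof.
have [y _] := carrier_nonempty A.
by move=> /approx_dense/(_ y)[x]; exact/le_lt_trans/mdist_ge0.
Qed.

Lemma tuple_dist_lt A n (a b : 'I_n -> A) (d : R) :
  0 < d -> (forall i, mdist (a i) (b i) < d) -> tuple_dist a b < d.
Proof. by move=> d0 ab; rewrite /tuple_dist; apply: bigmax_lt. Qed.

Lemma extend_close A B (iota : B -> A) n (v : 'I_n -> B) (w : 'I_n -> A)
    x y (d : R) :
    mdist (iota x) y < d -> (forall i, mdist (iota (v i)) (w i) < d) ->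
  forall i, mdist (iota (extend x v i)) (extend y w i) < d.
Proof. by move=> xy vw i; rewrite /extend; case: unlift. Qed.

Variable A : raw_structure L.
Hypothesis strA : is_structure A.

(** Rounding costs at most [e / 2] at the outermost symbol, and the modulus of [A] at [e / 2]
    absorbs the errors in the arguments. The threshold on [d] is uniform in [B] and in the
    assignments. *)
Lemma term_val_approx n (t : term L n) (e : R) : 0 < e ->
  \forall d \near 0^'+, forall B (iota : B -> A), approximates iota d ->
    forall v w, (forall i, mdist (iota (v i)) (w i) < d) ->
    mdist (iota (term_val v t)) (term_val w t) < e.
Proof.
elim: t e => [i|f ts IH] e e0.
  near=> d => B iota _ v w vw /=; apply: lt_trans (vw i) _.
  by near: d; exact: nbhs_right_lt.
have e20 : 0 < e / 2 by rewrite divr_gt0.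
have m0 := fmodulus_gt0 f e20.
near=> d => B iota appr v w vw /=; rewrite (splitr e).
pose b i := term_val v (ts i).
apply: le_lt_trans (metric_triangle _ (finterp (iota \o b)) _) _.
apply: ltr_leD.
  apply: lt_trans (approx_finterp appr b) _.
  by near: d; exact: nbhs_right_lt.
apply: strA.1 => //; apply: tuple_dist_lt => // i.
(* Everything chosen after [d] is generalized again; the finitely many arguments then share one
   threshold. *)
move: i B iota appr v w vw @b; near: d; apply: filter_forall => i.
by apply: filterS (IH i _ m0) => d Hd B iota appr v w vw b; exact: Hd.
Unshelve. all: by end_near. Qed.

(** Uniformity in the assignments lets a quantifier keep the threshold of its body: extending both
    assignments by close points keeps them close. *)
Lemma formula_val_approx n (phi : formula L n) (e : R) : 0 < e ->
  \forall d \near 0^'+, forall B (iota : B -> A), approximates iota d ->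
    forall v w, (forall i, mdist (iota (v i)) (w i) < d) ->
    `|formula_val phi v - formula_val phi w| <= e.
Proof.
elim: phi e => {n} [n t u|n P ts|n k c phis IH|n psi IH|n psi IH] e e0.
- have e20 : 0 < e / 2 by rewrite divr_gt0.
  apply: filterS2 (term_val_approx t e20) (term_val_approx u e20).
  move=> d td ud B iota appr v w vw /=; rewrite -(approx_isometry appr).
  apply: le_trans (mdist_dist_le _ _ _ _) _.
  by rewrite (splitr e) ltW// ltrD// ?td ?ud.
- have m0 := pmodulus_gt0 P e0.
  have : \forall d \near 0^'+, forall i, forall B (iota : B -> A),
      approximates iota d ->
      forall v w, (forall j, mdist (iota (v j)) (w j) < d) ->
      mdist (iota (term_val v (ts i))) (term_val w (ts i)) < pmodulus P e.
    by apply: filter_forall => i; exact: term_val_approx.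
  apply: filterS => d tsd B iota appr v w vw /=.
  rewrite (approx_pinterp appr); apply: strA.2 => //.
  by apply: tuple_dist_lt => // i; exact: tsd.
- have := compact_uniform_continuity (@compact_unit_cube R k)
            (@conn_continuous _ _ c) e0.
  move=> near_c.
  (* The induction hypothesis needs a fixed tolerance; [eta / 2] turns its weak inequality into the
     strict one of [ball]. *)
  have [eta [eta0 ceta]] : exists eta : R, 0 < eta /\
      forall x y, unit_cube x -> unit_cube y -> ball x eta y ->
        `|c x - c y| < e.
    near (0 : R)^'+ => eta; exists eta.
    split; first by near: eta; exact: nbhs_right_gt.
    by near: eta.
  have eta20 : 0 < eta / 2 by rewrite divr_gt0.
  have : \forall d \near 0^'+, forall i, forall B (iota : B -> A),
      approximates iota d ->
      forall v w, (forall j, mdist (iota (v j)) (w j) < d) ->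
      `|formula_val (phis i) v - formula_val (phis i) w| <= eta / 2.
    by apply: filter_forall => i; exact: IH.
  apply: filterS => d phisd B iota appr v w vw /=.
  apply/ltW/ceta => [i|i|]; rewrite ?mxE; try exact: formula_val_itv.
  split => // i j; rewrite !mxE /ball/=.
  apply: le_lt_trans (phisd _ _ _ appr _ _ vw) _.
  by rewrite ltr_pdivrMr// ltr_pMr// ltr1n.
- apply: filterS (IH e e0) => d psid B iota appr v w vw /=.
  have [[a _] [b _]] := (carrier_nonempty A, carrier_nonempty B).
  rewrite ler_distl lerBlDr; apply/andP; split.
    (* A point of [A] is matched with a nearby point of [B] by density; below, a point of [B] is
       matched with its image. *)
    apply: (@sup_range_le _ _ _ _ _ 1); first by exists a.
      by move=> y; case/andP: (formula_val_itv psi (extend y v)).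
    move=> y; have [x xy] := approx_dense appr y; exists x.
    have := psid _ _ appr _ _ (extend_close xy vw).
    by rewrite ler_distl lerBlDr => /andP[].
  apply: (@sup_range_le _ _ _ _ _ 1); first by exists b.
    by move=> y; case/andP: (formula_val_itv psi (extend y w)).
  move=> x; exists (iota x).
  have xy : mdist (iota x) (iota x) < d by rewrite mdistxx (approx_gt0 appr).
  have := psid _ _ appr _ _ (extend_close xy vw).
  by rewrite ler_distl => /andP[].
- apply: filterS (IH e e0) => d psid B iota appr v w vw /=.
  have [[a _] [b _]] := (carrier_nonempty A, carrier_nonempty B).
  rewrite ler_distl lerBlDr; apply/andP; split.
    (* For infima the two matchings trade places. *)
    apply: (@inf_range_le _ _ _ _ _ 0); first by exists b.
      by move=> y; case/andP: (formula_val_itv psi (extend y w)).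
    move=> x; exists (iota x).
    have xy : mdist (iota x) (iota x) < d by rewrite mdistxx (approx_gt0 appr).
    have := psid _ _ appr _ _ (extend_close xy vw).
    by rewrite ler_distl lerBlDr => /andP[].
  apply: (@inf_range_le _ _ _ _ _ 0); first by exists a.
    by move=> y; case/andP: (formula_val_itv psi (extend y v)).
  move=> y; have [x xy] := approx_dense appr y; exists x.
  have := psid _ _ appr _ _ (extend_close xy vw).
  by rewrite ler_distl => /andP[].
Unshelve. all: by end_near. Qed.

End Approximation.

(** * Finite subsets as complete metric spaces *)

Definition fset_space (R : realType) (T : metricType R) (S : {fset T}) :
  Type := S.

Section FsetSpace.
Variables (R : realType) (T : metricType R) (S : {fset T}).

HB.instance Definition _ := Finite.on (fset_space S).

Definition fset_dist (x y : fset_space S) : R := mdist (val x) (val y).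

Let fset_distxx x : fset_dist x x = 0. Proof. exact: mdistxx. Qed.

Let fset_dist_positivity x y : fset_dist x y = 0 -> x = y.
Proof. by move=> /mdist_positivity/val_inj. Qed.

Let fset_dist_sym x y : fset_dist x y = fset_dist y x.
Proof. exact: metric_sym. Qed.

Let fset_dist_triangle y x z : fset_dist x z <= fset_dist x y + fset_dist y z.
Proof. exact: metric_triangle. Qed.

HB.instance Definition _ := isMetric.Build R (fset_space S)
  fset_distxx fset_dist_positivity fset_dist_sym fset_dist_triangle.

End FsetSpace.

(** A Cauchy filter contains a ball whose radius is below every nonzero distance; this ball is a
    single point, the limit. *)
Lemma fset_space_complete (R : realType) (T : metricType R) (S : {fset T})
    (F : set_system (fset_space S)) :
  ProperFilter F -> cauchy F -> exists x : fset_space S, F --> x.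
Proof.
move=> FF /cauchyP Fcauchy.
have [e [e0 gap]] : exists e : R, 0 < e /\
    forall xy : fset_space S * fset_space S,
      mdist xy.1 xy.2 <= e -> mdist xy.1 xy.2 <= 0.
  near (0 : R)^'+ => e; exists e; split; first by near: e; exact: nbhs_right_gt.
  by near: e; exact: near_finite_gap.
have [x Fx] := Fcauchy _ e0; exists x => U /nbhs_singleton Ux.
apply: filterS Fx => y; rewrite ballEmdist /= => /ltW /(gap (x, y)) /= xy.
suff <- : x = y by [].
by apply: mdist_positivity; apply/eqP; rewrite eq_le xy mdist_ge0.
Unshelve. all: by end_near. Qed.

(** * The almost structure on a finite net *)

Section Net.
Variables (R : realType) (L : signature R) (A : raw_structure L).
Variables (S : {fset A}) (r : A -> fset_space S).

Definition net_point (x : fset_space S) : A := val x.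

Let net_nonempty : [set: fset_space S] !=set0.
Proof. by have [x _] := carrier_nonempty A; exists (r x). Qed.

Let net_diam (x y : fset_space S) : mdist x y <= 1.
Proof. exact: carrier_diam. Qed.

Definition net_structure : raw_structure L := @RawStructure R L (fset_space S)
  net_nonempty (@fset_space_complete R A S) net_diam
  (fun f a => r (finterp (net_point \o a)))
  (fun P a => pinterp (net_point \o a))
  (fun P a => pinterp_itv (net_point \o a)).

Lemma net_structure_finite : Defs.is_finite net_structure.
Proof. exact: (@finite_finset (fset_space S)). Qed.

Lemma net_structure_almost :
  is_structure A -> is_almost_structure net_structure.
Proof.
move=> [Af Ap]; split=> [f|P]; last first.
  near=> e => a b; apply: Ap; near: e; exact: nbhs_right_gt.
(* Tuples are encoded as finite functions so that pairs of them form a finite type. *)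
pose g (ab : {ffun 'I_(farity f) -> fset_space S} *
             {ffun 'I_(farity f) -> fset_space S}) : R :=
  mdist (finterp (net_point \o ab.1)) (finterp (net_point \o ab.2)).
near=> e => a b ab.
have e0 : 0 < e by near: e; exact: nbhs_right_gt.
have gap : forall t, g t <= e -> g t <= 0.
  by near: e; exact: near_finite_gap.
have finfunK (c : 'I_(farity f) -> fset_space S) : finfun c = c :> (_ -> _).
  by apply/funext => i; rewrite ffunE.
have := gap (finfun a, finfun b); rewrite /g /= !finfunK => gle0.
suff eqf : finterp (net_point \o a) = finterp (net_point \o b).
  by rewrite /= eqf mdistxx ltW.
apply: mdist_positivity; apply/eqP; rewrite eq_le mdist_ge0 andbT.
(* The net carries the metric of [A], so [ab] is also the premise of the modulus clause in [A]. *)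
by apply: gle0; exact: Af.
Unshelve. all: by end_near. Qed.

Lemma net_structure_approximates (d : R) :
  (forall x, mdist (net_point (r x)) x < d) ->
  @approximates R L A net_structure net_point d.
Proof.
move=> rd; split=> [x y|y|f a|P a]; [by []|by exists (r y)|exact: rd|by []].
Qed.

End Net.

(** * Finite nets and the transfer to compact structures *)

Lemma compact_finite_net (R : realType) (T : metricType R) (d : R) :
    compact [set: T] -> 0 < d -> [set: T] !=set0 ->
  exists (S : {fset T}) (r : T -> fset_space S),
    forall x, mdist (val (r x)) x < d.
Proof.
move=> Tcompact d0 [x0 _].
pose pT : ptopologicalType := HB.pack T (isPointed.Build T x0).
have Tcover : @cover_compact pT [set: T] by rewrite -compact_cover.
(* The centres of a finite subcover form the net; interiors make the cover open. *)
have [||S _ Scover] := Tcover _ [set: T] (fun x => (ball x d)^°).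
- by move=> x _; exact: open_interior.
- by move=> x _; exists x => //; apply: nbhsx_ballx.
have near_pt x : exists s : fset_space S, mdist (val s) x < d.
  have [y /= yS /interior_subset] := Scover x I.
  by rewrite ballEmdist /= => yx; exists [` yS]%fset.
by have [r rd] := choice near_pt; exists S, r.
Qed.

Lemma compact_almost_pseudofinite (R : realType) (L : signature R)
    (A : raw_structure L) :
  is_structure A -> is_compact A -> almost_pseudofinite A.
Proof.
move=> strA cA s s0; apply/eqP; rewrite eq_le; apply/andP; split; last first.
  by have /andP[] := formula_val_itv s (@no_vars A).
apply/ler_addgt0Pl => e e0; rewrite addr0.
near (0 : R)^'+ => d.
have d0 : 0 < d by near: d; exact: nbhs_right_gt.
have [S [r rd]] := compact_finite_net cA d0 (carrier_nonempty A).
have appr := net_structure_approximates rd.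
have sB := s0 _ (net_structure_almost r strA) (net_structure_finite r).
suff : `|sentence_val (net_structure r) s - sentence_val A s| <= e.
  by rewrite sB sub0r normrN; apply: le_trans; exact: ler_norm.
(* Stated for all [B], because the net is chosen only after [d]. *)
have close : forall (B : raw_structure L) (iota : B -> A),
    approximates iota d ->
    forall v w, (forall i, mdist (iota (v i)) (w i) < d) ->
    `|formula_val s v - formula_val s w| <= e.
  by near: d; exact: formula_val_approx.
(* With no free variables, closeness of the assignments is vacuous. *)
by apply: close appr _ _ _; case.
Unshelve. all: by end_near. Qed.

Theorem proposition5p8 (R : realType) (L : signature R) :
  (forall A : raw_structure L,
     is_structure A -> is_compact A -> almost_pseudofinite A) /\
  (forall Z : raw_structure L, is_structure Z ->
     (pseudocompact Z -> almost_pseudofinite Z) /\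
     (almost_pseudofinite Z -> almost_pseudocompact Z)).
Proof.
split=> [A|Z _]; first exact: compact_almost_pseudofinite.
(* In each case the sentences to be tested for the conclusion are among those covered by the
   hypothesis on [Z]: by the first claim, then because finite spaces are compact. *)
split=> ZP s s0; apply: ZP => A strA.
  by move=> cA; exact: compact_almost_pseudofinite.
by move=> finA; apply: s0 => //; exact: finite_compact.
Qed.
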